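(* Let $a,b,c$ be real numbers with $a\ge c>0$ and $b\ge c>0$, and let $\mu\in\mathbb{R}$. If $f(z)=z+\sum_{k=2}^{\infty}a_kz^k$ belongs to the class $\mathcal{R}_{a,b}^{c}$, then $$|a_3-\mu a_2^2|\le\begin{cases}\dfrac{(c)_2}{2(a)_2(b)_2}\left(\dfrac{-(c+1)ab-\mu c(a+1)(b+1)}{2ab(c+1)}\right), & \mu<\dfrac{-5(c+1)ab}{c(a+1)(b+1)},\\[3mm] \dfrac{(c)_2}{(a)_2(b)_2}, & \dfrac{-5(c+1)ab}{c(a+1)(b+1)}\le\mu\le\dfrac{3(c+1)ab}{c(a+1)(b+1)},\\[3mm] \dfrac{(c)_2}{2(a)_2(b)_2}\left(\dfrac{(c+1)ab+\mu c(a+1)(b+1)}{2ab(c+1)}\right), & \mu>\dfrac{3ab(c+1)}{c(a+1)(b+1)}.\end{cases}$$ The estimate is sharp for the functions $f$ defined in $\mathcal{U}$ by $$f(z)=\begin{cases} z\,{}_1F_2(c,b,a;z)*4z\sqrt{1+z^2}, & \dfrac{-5(c+1)ab}{c(a+1)(b+1)}\le\mu\le\dfrac{3(c+1)ab}{c(a+1)(b+1)},\\[3mm] z\,{}_1F_2(c,b,a;z)*\dfrac{-z}{2}(1+z)^{-1}, & \mu<\dfrac{-5(c+1)ab}{c(a+1)(b+1)}\ \text{ or }\ \mu>\dfrac{3ab(c+1)}{c(a+1)(b+1)}.\end{cases}$$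
   Context: $\mathcal{U}=\{z\in\mathbb{C}:|z|<1\}$. $\mathcal{A}$ is the class of functions analytic in $\mathcal{U}$ of the form $f(z)=z+\sum_{k\ge2}a_kz^k$. $(\alpha)_0=1$ and $(\alpha)_n=\alpha(\alpha+1)\cdots(\alpha+n-1)$ for $n\ge1$. $*$ denotes the Hadamard product (coefficientwise product of power series). The Hohlov operator $\mathcal{I}_{a,b}^{c}:\mathcal{A}\to\mathcal{A}$ is $\mathcal{I}_{a,b}^{c}f(z)=z\,{}_2F_1(a,b;c;z)*f(z)=z+\sum_{n\ge1}\frac{(a)_n(b)_n}{(c)_n\,n!}a_{n+1}z^{n+1}$. For $g,h$ analytic in $\mathcal{U}$, $g\prec h$ means $g(z)=h(\omega(z))$ for some analytic $\omega$ on $\mathcal{U}$ with $\omega(0)=0$, $|\omega(z)|<1$. The class $\mathcal{R}_{a,b}^{c}$ consists of all $f\in\mathcal{A}$ with $\frac{\mathcal{I}_{a,b}^{c}f(z)}{z}\prec\sqrt{1+z}$ in $\mathcal{U}$ (principal branch). ${}_1F_2(c,b,a;z)=\sum_{n\ge0}\frac{(c)_n}{(b)_n(a)_n}\frac{z^n}{n!}$. ''Sharp for a function'' means equality holds in the estimate for that function, with $a_k$ its coefficient of $z^k$. *)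

(* Defs.v *)
From Stdlib Require Export Factorial Reals Lra ClassicalEpsilon.
From Coquelicot Require Export Coquelicot.
Open Scope R_scope.

Definition in_disc (z : C) : Prop := Cmod z < 1.

Definition analytic_disc (f : C -> C) : Prop :=
  forall z, in_disc z -> @ex_derive C_AbsRing C_NormedModule f z.

(** [f z = sum_n p n * z ^ n] for every [z] in the unit disc. *)
Definition expansion (f : C -> C) (p : nat -> C) : Prop :=
  forall z, in_disc z -> @is_pseries C_AbsRing C_NormedModule p z (f z).

(** Sum of a complex series, taken coordinatewise because Coquelicot's total
    operator [Series] is real-valued; see [CSeries_unique]. *)
Definition CSeries (u : nat -> C) : C :=
  (Series (fun n => Re (u n)), Series (fun n => Im (u n))).

(** The coefficients of the power series of [f]. They are unique when they
    exist ([coeff_unique]); the value is meaningless for a function without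
    a power series expansion in the disc. *)
Definition coeff (f : C -> C) : nat -> C :=
  epsilon (inhabits (fun _ : nat => RtoC 0)) (expansion f).

Definition hadamard (f g : C -> C) (z : C) : C :=
  CSeries (fun n => coeff f n * coeff g n * z ^ n)%C.

Definition class_A (f : C -> C) : Prop :=
  analytic_disc f /\
  exists p : nat -> C, p 0%nat = RtoC 0 /\ p 1%nat = RtoC 1 /\ expansion f p.

Fixpoint pochhammer (x : R) (n : nat) : R :=
  match n with
  | O => 1
  | S m => pochhammer x m * (x + INR m)
  end.

Definition hyp2F1 (a b c : R) (z : C) : C :=
  CSeries (fun n =>
    RtoC (pochhammer a n * pochhammer b n / (pochhammer c n * INR (fact n)))
    * z ^ n)%C.

Definition hyp1F2 (a b1 b2 : R) (z : C) : C :=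
  CSeries (fun n =>
    RtoC (pochhammer a n / (pochhammer b1 n * pochhammer b2 n * INR (fact n)))
    * z ^ n)%C.

Definition hohlov (a b c : R) (f : C -> C) : C -> C :=
  hadamard (fun z => z * hyp2F1 a b c z)%C f.

(** The function [g z / z], with its removable singularity at the origin
    filled in by the limit. *)
Definition quot_id (g : C -> C) (z : C) : C :=
  if Ceq_dec z 0 then C_lim (fun w => g w / w)%C 0 else (g z / z)%C.

Definition subordinate (g h : C -> C) : Prop :=
  exists omega : C -> C,
    analytic_disc omega /\ omega (RtoC 0) = RtoC 0 /\
    (forall z, in_disc z -> Cmod (omega z) < 1) /\
    (forall z, in_disc z -> g z = h (omega z)).

(** Principal square root: the root with argument in (-pi/2, pi/2], given by
    the half-angle formulas. *)
Definition Csqrt (z : C) : C :=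
  (sqrt ((Cmod z + Re z) / 2),
   (if Rle_dec 0 (Im z) then 1 else -1) * sqrt ((Cmod z - Re z) / 2)).

Definition class_R (a b c : R) (f : C -> C) : Prop :=
  class_A f /\
  subordinate (quot_id (hohlov a b c f)) (fun z => Csqrt (1 + z)%C).

Definition mu_low (a b c : R) : R :=
  -5 * (c + 1) * a * b / (c * (a + 1) * (b + 1)).

Definition mu_high (a b c : R) : R :=
  3 * (c + 1) * a * b / (c * (a + 1) * (b + 1)).

Definition fs_bound (a b c mu : R) : R :=
  if Rlt_dec mu (mu_low a b c) then
    pochhammer c 2 / (2 * pochhammer a 2 * pochhammer b 2)
    * ((- (c + 1) * a * b - mu * c * (a + 1) * (b + 1))
       / (2 * a * b * (c + 1)))
  else if Rle_dec mu (mu_high a b c) then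
    pochhammer c 2 / (pochhammer a 2 * pochhammer b 2)
  else
    pochhammer c 2 / (2 * pochhammer a 2 * pochhammer b 2)
    * (((c + 1) * a * b + mu * c * (a + 1) * (b + 1))
       / (2 * a * b * (c + 1))).

(** The functions [extremal_mid] and [extremal_out] are not normalised (their
    coefficients of [z] are [4] and [-1/2]), hence not in [class_A]; sharpness
    for them means equality in the estimate for their coefficients. *)
Definition extremal_mid (a b c : R) : C -> C :=
  hadamard (fun z => z * hyp1F2 c b a z)%C
           (fun z => 4 * z * Csqrt (1 + z ^ 2))%C.

Definition extremal_out (a b c : R) : C -> C :=
  hadamard (fun z => z * hyp1F2 c b a z)%C
           (fun z => - z / 2 * / (1 + z))%C.

Definition extremal (a b c mu : R) : C -> C :=
  if Rlt_dec mu (mu_low a b c) then extremal_out a b c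
  else if Rle_dec mu (mu_high a b c) then extremal_mid a b c
  else extremal_out a b c.

Lemma is_series_C (u : nat -> C) (l : C) :
  @is_series C_AbsRing C_NormedModule u l ->
  is_series (fun n => Re (u n)) (Re l) /\ is_series (fun n => Im (u n)) (Im l).
Proof.
intros H.
assert (E : forall n, @sum_n C_AbelianMonoid u n
          = (sum_n (fun k => Re (u k)) n, sum_n (fun k => Im (u k)) n)).
{ intros n; induction n as [|n IH].
  - rewrite !sum_O; destruct (u 0%nat); reflexivity.
  - rewrite !sum_Sn, IH; reflexivity. }
split; apply filterlim_locally; intros eps;
  generalize (proj1 (@filterlim_locally _ C_UniformSpace _ _ _ _) H eps);
  apply filter_imp; intros n Hn.
- assert (Hn' : ball l eps (@sum_n C_AbelianMonoid u n)) by exact Hn.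
  rewrite E in Hn'; exact (proj1 Hn').
- assert (Hn' : ball l eps (@sum_n C_AbelianMonoid u n)) by exact Hn.
  rewrite E in Hn'; exact (proj2 Hn').
Qed.

Lemma CSeries_unique (u : nat -> C) (l : C) :
  @is_series C_AbsRing C_NormedModule u l -> CSeries u = l.
Proof.
intros H; destruct (is_series_C _ _ H) as [H1 H2]; unfold CSeries.
rewrite (is_series_unique _ _ H1), (is_series_unique _ _ H2).
destruct l; reflexivity.
Qed.

Lemma expansion_real (f : C -> C) (p : nat -> C) (x : R) :
  expansion f p -> Rabs x < 1 ->
  is_pseries (fun n => Re (p n)) x (Re (f (RtoC x))) /\
  is_pseries (fun n => Im (p n)) x (Im (f (RtoC x))).
Proof.
intros H Hx.
assert (Hd : in_disc (RtoC x)) by (unfold in_disc; rewrite Cmod_R; exact Hx).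
destruct (is_series_C _ _ (H _ Hd)) as [H1 H2].
assert (P : forall n, @pow_n C_AbsRing (RtoC x) n = RtoC (@pow_n R_AbsRing x n)).
{ intros n; induction n as [|n IH]; [reflexivity|].
  simpl pow_n; rewrite IH; symmetry; exact (RtoC_mult x (@pow_n R_AbsRing x n)). }
split; [revert H1 | revert H2]; apply is_series_ext; intros n;
  cbv beta; rewrite P; generalize (@pow_n R_AbsRing x n) (p n); intros y [u v].
- change (y * u - 0 * v = y * u); ring.
- change (y * v + 0 * u = y * v); ring.
Qed.

Lemma expansion_unique (f : C -> C) (p q : nat -> C) :
  expansion f p -> expansion f q -> forall n, p n = q n.
Proof.
intros Hp Hq.
assert (R0 : forall u v : nat -> R,
  (forall x, Rabs x < 1 -> exists l : R, is_pseries u x l /\ is_pseries v x l) ->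
  forall n, u n = v n).
{ intros u v H.
  assert (CV : forall w : nat -> R,
    (forall x, Rabs x < 1 -> exists l : R, is_pseries w x l) ->
    Rbar_lt 0 (CV_radius w)).
  { intros w Hw.
    apply Rbar_lt_le_trans with (Rabs (1 / 2)).
    - simpl; rewrite Rabs_pos_eq; lra.
    - destruct (Hw (1 / 2)) as [l Hl]; [rewrite Rabs_pos_eq; lra|].
      apply Rbar_not_lt_le; intros Hlt.
      apply CV_disk_outside in Hlt; apply Hlt.
      apply (ex_series_lim_0 (fun k => w k * (1 / 2) ^ k)).
      apply ex_pseries_R; exists l; exact Hl. }
  intros n; apply PSeries_ext_recip.
  - apply CV; intros x Hx; destruct (H x Hx) as [l [H1 _]]; exists l; exact H1.
  - apply CV; intros x Hx; destruct (H x Hx) as [l [_ H2]]; exists l; exact H2.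
  - exists (mkposreal 1 Rlt_0_1); intros x Hx.
    assert (Hx' : Rabs x < 1).
    { change (Rabs (x - 0) < 1) in Hx; rewrite Rminus_0_r in Hx; exact Hx. }
    destruct (H x Hx') as [l [H1 H2]].
    rewrite (is_pseries_unique _ _ _ H1), (is_pseries_unique _ _ _ H2).
    reflexivity. }
intros n.
assert (H1 : Re (p n) = Re (q n)).
{ apply (R0 (fun n => Re (p n)) (fun n => Re (q n))); intros x Hx.
  exists (Re (f (RtoC x))); split; apply expansion_real; assumption. }
assert (H2 : Im (p n) = Im (q n)).
{ apply (R0 (fun n => Im (p n)) (fun n => Im (q n))); intros x Hx.
  exists (Im (f (RtoC x))); split; apply expansion_real; assumption. }
destruct (p n), (q n); simpl in H1, H2; subst; reflexivity.
Qed.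

Lemma coeff_unique (f : C -> C) (p : nat -> C) :
  expansion f p -> forall n, coeff f n = p n.
Proof.
intros H; apply (expansion_unique f); [|exact H].
unfold coeff; apply epsilon_spec; exists p; exact H.
Qed.

Lemma Csqrt_sqr (z : C) : (Csqrt z * Csqrt z)%C = z.
Proof.
assert (Hm := re_le_Cmod z).
assert (H0 := Cmod_ge_0 z).
assert (H2 := Cmod2_alt z).
assert (Ha : 0 <= (Cmod z + Re z) / 2).
{ assert (- Cmod z <= Re z) by (apply Rabs_le_between in Hm; lra); lra. }
assert (Hb : 0 <= (Cmod z - Re z) / 2).
{ assert (Re z <= Cmod z) by (apply Rabs_le_between in Hm; lra); lra. }
assert (Hab : sqrt ((Cmod z + Re z) / 2) * sqrt ((Cmod z - Re z) / 2)
              = Rabs (Im z) / 2).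
{ rewrite <- sqrt_mult by assumption.
  replace ((Cmod z + Re z) / 2 * ((Cmod z - Re z) / 2))
    with (Rsqr (Im z / 2)) by (unfold Rsqr; nra).
  rewrite sqrt_Rsqr_abs; unfold Rdiv; rewrite Rabs_mult, (Rabs_pos_eq (/ 2)); lra. }
assert (Sa := sqrt_sqrt _ Ha).
assert (Sb := sqrt_sqrt _ Hb).
unfold Csqrt, Cmult; simpl.
set (s := sqrt ((Cmod z + Re z) / 2)) in *.
set (t := sqrt ((Cmod z - Re z) / 2)) in *.
destruct z as [x y]; simpl in *; apply injective_projections; simpl.
- destruct (Rle_dec 0 y); nra.
- destruct (Rle_dec 0 y) as [Hy|Hy].
  + rewrite Rabs_pos_eq in Hab by exact Hy; nra.
  + rewrite Rabs_left in Hab by lra; nra.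
Qed.

Lemma Csqrt_Re_ge0 (z : C) : 0 <= Re (Csqrt z).
Proof. apply sqrt_pos. Qed.

(* Main.v *)
Require Import Defs.
From Stdlib Require Import Lia Psatz.

(** If [f] is in the class then [G z = I f z / z] satisfies [G ^ 2 = 1 + omega] with
    [omega] a Schwarz function, so [omega = w_1 z + w_2 z ^ 2 + ...] with [w_1], [w_2]
    determined by [a_2], [a_3], and
    [a_3 - mu a_2 ^ 2 = K (w_2 - t w_1 ^ 2)] for
    [K = (c)_2 / ((a)_2 (b)_2)] and a real [t] affine in [mu]. The classical bound
    [|w_2 - t w_1 ^ 2| <= max (1, |t|)] gives the three cases ([t < -1],
    [|t| <= 1], [t > 1]); it follows from [|w_2| <= 1 - |w_1| ^ 2].
    The latter says that the triangular Toeplitz matrix of [w_1, w_2] is a contraction,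
    which is proved by comparing the means of [|omega (1 + q z)| ^ 2] and
    [|1 + q z| ^ 2] over a circle. The only consequence of the mean value property
    that this needs is: if [H 0 = 0] and [Re H <= K] on a circle, then [K >= 0]. *)

(** * Complex power series in the unit disc *)

(** Convergence is stated by coordinates so that theorems on real series apply to each one and the
    sum agrees with [CSeries]; [expansionE] is the link with [expansion]. *)
Definition Csums (u : nat -> C) (l : C) : Prop :=
  is_series (fun n => Re (u n)) (Re l) /\ is_series (fun n => Im (u n)) (Im l).

Lemma C_eq (u v : C) : Re u = Re v -> Im u = Im v -> u = v.
Proof. destruct u, v; simpl; intros; subst; reflexivity. Qed.

Lemma Csums_ext (u v : nat -> C) (l : C) :
  (forall n, u n = v n) -> Csums u l -> Csums v l.
Proof.
intros E [H1 H2]; split.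
- apply (is_series_ext (fun n => Re (u n))); [intros n; now rewrite E | exact H1].
- apply (is_series_ext (fun n => Im (u n))); [intros n; now rewrite E | exact H2].
Qed.

Lemma Csums_CSeries (u : nat -> C) (l : C) : Csums u l -> CSeries u = l.
Proof.
intros [H1 H2]; unfold CSeries.
rewrite (is_series_unique _ _ H1), (is_series_unique _ _ H2).
destruct l; reflexivity.
Qed.

Lemma Csums_inj (u : nat -> C) (l m : C) : Csums u l -> Csums u m -> l = m.
Proof. intros H K; rewrite <- (Csums_CSeries _ _ H); exact (Csums_CSeries _ _ K). Qed.

Lemma Csums_plus (u v : nat -> C) (l m : C) :
  Csums u l -> Csums v m -> Csums (fun n => u n + v n)%C (l + m)%C.
Proof.
intros [H1 H2] [K1 K2]; split.
- exact (is_series_plus _ _ _ _ H1 K1).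
- exact (is_series_plus _ _ _ _ H2 K2).
Qed.

Lemma Csums_mult_l (k : C) (u : nat -> C) (l : C) :
  Csums u l -> Csums (fun n => k * u n)%C (k * l)%C.
Proof.
intros [H1 H2]; split.
- exact (is_series_minus _ _ _ _
    (is_series_scal_l (Re k) _ _ H1) (is_series_scal_l (Im k) _ _ H2)).
- exact (is_series_plus _ _ _ _
    (is_series_scal_l (Re k) _ _ H2) (is_series_scal_l (Im k) _ _ H1)).
Qed.

Lemma is_series_value (u : nat -> R) (l m : R) :
  is_series u l -> l = m -> is_series u m.
Proof. intros H E; now rewrite <- E. Qed.

Lemma Csums_cons (u : nat -> C) (l : C) :
  Csums (fun n => u (S n)) l -> Csums u (u 0%nat + l)%C.
Proof.
intros [H1 H2]; split; apply is_series_decr_1.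
- apply (is_series_value _ _ _ H1); simpl.
  change (Re l = Re (u 0%nat) + Re l + - Re (u 0%nat)); ring.
- apply (is_series_value _ _ _ H2); simpl.
  change (Im l = Im (u 0%nat) + Im l + - Im (u 0%nat)); ring.
Qed.

Lemma is_series_Csums (u : nat -> C) (l : C) :
  Csums u l -> @is_series C_AbsRing C_NormedModule u l.
Proof.
intros [H1 H2].
assert (E : forall n, @sum_n C_AbelianMonoid u n
          = (sum_n (fun k => Re (u k)) n, sum_n (fun k => Im (u k)) n)).
{ intros n; induction n as [|n IH].
  - rewrite !sum_O; destruct (u 0%nat); reflexivity.
  - rewrite !sum_Sn, IH; reflexivity. }
apply (proj2 (@filterlim_locally _ C_UniformSpace _ _ _ _)); intros eps.
generalize (filter_and _ _ (proj1 (filterlim_locally _ _) H1 eps)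
                           (proj1 (filterlim_locally _ _) H2 eps)).
apply filter_imp; intros n [A B].
change (ball l eps (@sum_n C_AbelianMonoid u n)); rewrite E; split; assumption.
Qed.

Lemma expansionE (f : C -> C) (p : nat -> C) :
  expansion f p <->
  forall z, in_disc z -> Csums (fun n => p n * z ^ n)%C (f z).
Proof.
assert (P : forall (z : C) n, @scal C_AbsRing C_NormedModule (@pow_n C_AbsRing z n) (p n)
   = (p n * z ^ n)%C).
{ intros z n.
  change (@pow_n C_AbsRing z n * p n = p n * z ^ n)%C; apply Cmult_comm. }
split; intros H z Hz.
- apply Csums_ext with (2 := is_series_C _ _ (H z Hz)); exact (P z).
- apply is_series_Csums, Csums_ext with (2 := H z Hz); intros n; symmetry; apply P.
Qed.

Lemma im_le_Cmod (z : C) : Rabs (Im z) <= Cmod z.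
Proof.
rewrite <- (Rabs_pos_eq (Cmod z)) by apply Cmod_ge_0.
apply Rsqr_le_abs_0; generalize (Cmod2_alt z); unfold Rsqr; nra.
Qed.

Lemma Csums_exists (u : nat -> C) (M q : R) :
  0 <= q < 1 -> (forall n, Cmod (u n) <= M * q ^ n) -> Csums u (CSeries u).
Proof.
intros Hq H.
assert (E : ex_series (fun n => M * q ^ n)).
{ assert (Hq' : Rabs q < 1) by (rewrite Rabs_pos_eq; lra).
  exists (M * / (1 - q)).
  exact (@is_series_scal_l R_AbsRing R_NormedModule M _ _ (is_series_geom q Hq')). }
split; apply Series_correct.
- apply (@ex_series_le _ R_CompleteNormedModule _ _) with (2 := E); intros n.
  apply Rle_trans with (2 := H n); exact (re_le_Cmod _).
- apply (@ex_series_le _ R_CompleteNormedModule _ _) with (2 := E); intros n.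
  apply Rle_trans with (2 := H n); exact (im_le_Cmod _).
Qed.

(** Coefficients of a power series of radius of convergence at least 1. *)
Definition disc_coeffs (p : nat -> C) : Prop :=
  forall r, 0 <= r < 1 -> exists M, forall n, Cmod (p n) * r ^ n <= M.

Lemma Cmod_le_abs (z : C) : Cmod z <= Rabs (Re z) + Rabs (Im z).
Proof.
apply Rsqr_incr_0_var; [|generalize (Rabs_pos (Re z)) (Rabs_pos (Im z)); lra].
generalize (Cmod2_alt z) (Rabs_pos (Re z)) (Rabs_pos (Im z)).
rewrite <- (pow2_abs (Re z)), <- (pow2_abs (Im z)); unfold Rsqr; nra.
Qed.

(** At the real point [r] the terms tend to 0 in each coordinate, hence stay bounded. *)
Lemma disc_coeffs_expansion (f : C -> C) (p : nat -> C) :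
  expansion f p -> disc_coeffs p.
Proof.
intros H r Hr.
assert (Hd : in_disc (RtoC r)).
{ unfold in_disc; rewrite Cmod_R, Rabs_pos_eq; lra. }
destruct (proj1 (expansionE _ _) H _ Hd) as [H1 H2].
assert (B : forall u (l : R), is_series u l -> exists M, forall n, Rabs (u n) <= M).
{ intros u l Hu.
  assert (L : is_lim_seq u 0) by (apply ex_series_lim_0; exists l; exact Hu).
  destruct (@filterlim_bounded R_AbsRing R_NormedModule u) as [M HM].
  - exists 0; exact L.
  - exists M; exact HM. }
destruct (B _ _ H1) as [M1 K1]; destruct (B _ _ H2) as [M2 K2].
exists (M1 + M2); intros n.
specialize (K1 n); specialize (K2 n).
replace (Cmod (p n) * r ^ n) with (Cmod (p n * RtoC r ^ n)%C).
- apply Rle_trans with (1 := Cmod_le_abs _); lra.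
- rewrite Cmod_mult, Cmod_pow, Cmod_R, Rabs_pos_eq; lra.
Qed.

(** Boundedness at the larger radius [(1 + r) / 2] gives geometric decay at [r], the ratio [q] being
    the quotient of the two radii. *)
Lemma disc_coeffs_geom (p : nat -> C) (r : R) :
  disc_coeffs p -> 0 <= r < 1 ->
  exists M q, 0 <= q < 1 /\ forall n, Cmod (p n) * r ^ n <= M * q ^ n.
Proof.
intros Hp Hr; destruct (Hp ((1 + r) / 2)) as [M HM]; [lra|].
exists M, (r / ((1 + r) / 2)); split.
- split; [apply Rdiv_le_0_compat; lra|].
  apply Rlt_div_l; lra.
- intros n; specialize (HM n).
  replace (r ^ n) with (((1 + r) / 2) ^ n * (r / ((1 + r) / 2)) ^ n).
  + rewrite <- Rmult_assoc; apply Rmult_le_compat_r; [|exact HM].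
    apply pow_le, Rdiv_le_0_compat; lra.
  + rewrite <- Rpow_mult_distr; f_equal; field; lra.
Qed.

Lemma disc_coeffs_geomC (p : nat -> C) (z : C) :
  disc_coeffs p -> in_disc z ->
  exists M q, 0 <= q < 1 /\ forall n, Cmod (p n * z ^ n)%C <= M * q ^ n.
Proof.
intros Hp Hz; destruct (disc_coeffs_geom p (Cmod z) Hp) as [M [q [Hq H]]].
{ split; [apply Cmod_ge_0 | exact Hz]. }
exists M, q; split; [exact Hq|]; intros n; rewrite Cmod_mult, Cmod_pow; apply H.
Qed.

Lemma expansion_CSeries (p : nat -> C) :
  disc_coeffs p -> expansion (fun z => CSeries (fun n => p n * z ^ n)%C) p.
Proof.
intros Hp; apply expansionE; intros z Hz.
destruct (disc_coeffs_geomC p z Hp Hz) as [M [q [Hq H]]].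
exact (Csums_exists _ M q Hq H).
Qed.

Lemma disc_coeffs_mult (p q : nat -> C) :
  disc_coeffs p -> disc_coeffs q -> disc_coeffs (fun n => p n * q n)%C.
Proof.
intros Hp Hq r Hr.
destruct (Hp ((1 + r) / 2)) as [M HM]; [lra|].
destruct (Hq ((1 + r) / 2)) as [N HN]; [lra|].
exists (M * N); intros n; specialize (HM n); specialize (HN n).
rewrite Cmod_mult.
set (s := ((1 + r) / 2) ^ n) in *.
(* Since [r <= ((1 + r) / 2) ^ 2], each of the two sequences can absorb one factor [s]. *)
assert (Hs : r ^ n <= s * s).
{ unfold s; rewrite <- Rpow_mult_distr; apply pow_incr; split; [lra|]; nra. }
assert (0 <= s) by (apply pow_le; lra).
assert (H1 := Cmod_ge_0 (p n)); assert (H2 := Cmod_ge_0 (q n)).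
apply Rle_trans with ((Cmod (p n) * s) * (Cmod (q n) * s)).
- replace (Cmod (p n) * s * (Cmod (q n) * s))
    with (Cmod (p n) * Cmod (q n) * (s * s)) by ring.
  apply Rmult_le_compat_l; [nra | exact Hs].
- apply Rmult_le_compat; try assumption; nra.
Qed.

Lemma expansion_hadamard (f g : C -> C) (p q : nat -> C) :
  expansion f p -> expansion g q ->
  expansion (hadamard f g) (fun n => p n * q n)%C.
Proof.
intros Hf Hg; apply expansionE; intros z Hz.
assert (H := expansion_CSeries _ (disc_coeffs_mult _ _
  (disc_coeffs_expansion _ _ Hf) (disc_coeffs_expansion _ _ Hg))).
assert (K := proj1 (expansionE _ _) H z Hz); cbv beta in K.
replace (hadamard f g z) with (CSeries (fun n => p n * q n * z ^ n)%C); [exact K|].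
symmetry; apply Csums_CSeries; apply Csums_ext with (2 := K).
intros n; now rewrite (coeff_unique _ _ Hf), (coeff_unique _ _ Hg).
Qed.

Lemma expansion_ext (f g : C -> C) (p q : nat -> C) :
  (forall z, in_disc z -> f z = g z) -> (forall n, p n = q n) ->
  expansion f p -> expansion g q.
Proof.
intros E F; rewrite !expansionE; intros H z Hz; rewrite <- (E z Hz).
apply Csums_ext with (2 := H z Hz); intros n; now rewrite F.
Qed.

Lemma expansion_value (f g : C -> C) (p : nat -> C) (z : C) :
  expansion f p -> expansion g p -> in_disc z -> f z = g z.
Proof.
rewrite !expansionE; intros H K Hz; exact (Csums_inj _ _ _ (H z Hz) (K z Hz)).
Qed.

Lemma expansion_plus (f g : C -> C) (p q : nat -> C) :
  expansion f p -> expansion g q ->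
  expansion (fun z => f z + g z)%C (fun n => p n + q n)%C.
Proof.
rewrite !expansionE; intros H K z Hz.
apply Csums_ext with (2 := Csums_plus _ _ _ _ (H z Hz) (K z Hz)); intros n.
cbv beta; ring.
Qed.

Lemma expansion_scal (k : C) (f : C -> C) (p : nat -> C) :
  expansion f p -> expansion (fun z => k * f z)%C (fun n => k * p n)%C.
Proof.
rewrite !expansionE; intros H z Hz.
apply Csums_ext with (2 := Csums_mult_l k _ _ (H z Hz)); intros n; cbv beta; ring.
Qed.

Definition shift_in (k : C) (p : nat -> C) (n : nat) : C :=
  match n with O => k | S m => p m end.

Lemma expansion_cons (k : C) (f : C -> C) (p : nat -> C) :
  expansion f p -> expansion (fun z => k + z * f z)%C (shift_in k p).
Proof.
rewrite !expansionE; intros H z Hz.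
assert (E : (k + z * f z = shift_in k p 0 * z ^ 0 + z * f z)%C) by (simpl; ring).
rewrite E; apply (Csums_cons (fun n => shift_in k p n * z ^ n)%C).
apply Csums_ext with (2 := Csums_mult_l z _ _ (H z Hz)); intros n; simpl; ring.
Qed.

Lemma disc_coeffs_shift_out (p : nat -> C) :
  disc_coeffs p -> disc_coeffs (fun n => p (S n)).
Proof.
intros Hp r Hr; destruct (Hp ((1 + r) / 2)) as [M HM]; [lra|].
exists (M / ((1 + r) / 2)); intros n; specialize (HM (S n)).
apply (Rle_div_r _ M ((1 + r) / 2)); [lra|].
apply Rle_trans with (2 := HM); simpl.
assert (K := Cmod_ge_0 (p (S n))).
assert (r ^ n <= ((1 + r) / 2) ^ n) by (apply pow_incr; lra).
rewrite Rmult_assoc; apply Rmult_le_compat_l; [exact K|].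
rewrite Rmult_comm; apply Rmult_le_compat_l; lra.
Qed.

Lemma expansion_at_0 (f : C -> C) (p : nat -> C) : expansion f p -> f 0 = p 0%nat.
Proof.
rewrite expansionE; intros H.
assert (H0 : in_disc 0) by (unfold in_disc; rewrite Cmod_0; lra).
apply (Csums_inj _ _ _ (H 0 H0)).
replace (p 0%nat) with (p 0%nat * 0 ^ 0 + 0)%C by (simpl; ring).
apply (Csums_cons (fun n => p n * 0 ^ n)%C).
(* The tail at the origin is termwise 0 times the whole series, so its sum is [0 * f 0]. *)
assert (K : Csums (fun n => p (S n) * 0 ^ S n)%C (0 * f 0)%C).
{ apply Csums_ext with (2 := Csums_mult_l 0 _ _ (H 0 H0)); intros n; simpl; ring. }
now rewrite Cmult_0_l in K.
Qed.

(** * Products, and the mean value inequality *)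

Definition Cconv (p q : nat -> C) (n : nat) : C :=
  (sum_f_R0 (fun k => Re (p k * q (n - k)%nat)%C) n,
   sum_f_R0 (fun k => Im (p k * q (n - k)%nat)%C) n).

(** The geometric majorants make all coordinate series absolutely convergent, and the complex
    product splits into four real Cauchy products. *)
Lemma Csums_conv (u v : nat -> C) (l m : C) (M q N r : R) :
  0 <= q < 1 -> 0 <= r < 1 ->
  (forall n, Cmod (u n) <= M * q ^ n) -> (forall n, Cmod (v n) <= N * r ^ n) ->
  Csums u l -> Csums v m -> Csums (Cconv u v) (l * m)%C.
Proof.
intros Hq Hr Hu Hv [U1 U2] [V1 V2].
assert (B : forall (w : nat -> C) (a : nat -> R) K s, 0 <= s < 1 ->
  (forall n, Cmod (w n) <= K * s ^ n) -> (forall n, Rabs (a n) <= Cmod (w n)) ->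
  ex_series (fun n => Rabs (a n))).
{ intros w a K s Hs Hw Ha.
  assert (Hs' : Rabs s < 1) by (rewrite Rabs_pos_eq; lra).
  apply (@ex_series_le R_AbsRing R_CompleteNormedModule _ (fun n => K * s ^ n)).
  - intros n; apply Rle_trans with (2 := Hw n).
    change (Rabs (Rabs (a n)) <= Cmod (w n)); rewrite Rabs_Rabsolu; apply Ha.
  - exists (K * / (1 - s)).
    exact (@is_series_scal_l R_AbsRing R_NormedModule K _ _ (is_series_geom s Hs')). }
assert (u1 := B u (fun n => Re (u n)) M q Hq Hu (fun n => re_le_Cmod _)).
assert (u2 := B u (fun n => Im (u n)) M q Hq Hu (fun n => im_le_Cmod _)).
assert (v1 := B v (fun n => Re (v n)) N r Hr Hv (fun n => re_le_Cmod _)).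
assert (v2 := B v (fun n => Im (v n)) N r Hr Hv (fun n => im_le_Cmod _)).
split.
- generalize (is_series_minus _ _ _ _ (is_series_mult _ _ _ _ U1 V1 u1 v1)
                                      (is_series_mult _ _ _ _ U2 V2 u2 v2)).
  apply is_series_ext; intros n.
  exact (eq_sym (minus_sum _ _ n)).
- generalize (is_series_plus _ _ _ _ (is_series_mult _ _ _ _ U1 V2 u1 v2)
                                     (is_series_mult _ _ _ _ U2 V1 u2 v1)).
  apply is_series_ext; intros n.
  exact (eq_sym (plus_sum _ _ n)).
Qed.

Lemma Cconv_pow (p q : nat -> C) (z : C) (n : nat) :
  Cconv (fun k => p k * z ^ k)%C (fun k => q k * z ^ k)%C n = (Cconv p q n * z ^ n)%C.
Proof.
assert (E : forall k, (k <= n)%nat ->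
  (p k * z ^ k * (q (n - k)%nat * z ^ (n - k)) = z ^ n * (p k * q (n - k)%nat))%C).
{ intros k Hk; replace n with (k + (n - k))%nat at 3 by lia.
  rewrite Cpow_add_r; ring. }
rewrite Cmult_comm.
apply C_eq; simpl; rewrite !scal_sum; [rewrite <- minus_sum | rewrite <- plus_sum];
  apply sum_eq; intros k Hk.
- transitivity (Re (z ^ n * (p k * q (n - k)%nat))%C); [now rewrite <- E|simpl; ring].
- transitivity (Im (z ^ n * (p k * q (n - k)%nat))%C); [now rewrite <- E|simpl; ring].
Qed.

Lemma expansion_mult (f g : C -> C) (p q : nat -> C) :
  expansion f p -> expansion g q -> expansion (fun z => f z * g z)%C (Cconv p q).
Proof.
intros Hf Hg; apply expansionE; intros z Hz.
destruct (disc_coeffs_geomC p z (disc_coeffs_expansion _ _ Hf) Hz) as [M [s [Hs Hp]]].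
destruct (disc_coeffs_geomC q z (disc_coeffs_expansion _ _ Hg) Hz) as [N [r [Hr Hq]]].
apply Csums_ext with (1 := fun n => Cconv_pow p q z n).
apply (Csums_conv _ _ _ _ M s N r); try assumption.
- exact (proj1 (expansionE _ _) Hf z Hz).
- exact (proj1 (expansionE _ _) Hg z Hz).
Qed.

(** The partial sums of the even-indexed terms are the partial sums of [u] at even ranks, a
    subsequence of a convergent sequence. *)
Lemma is_series_even (u : nat -> R) (l : R) :
  (forall n, u (2 * n + 1)%nat = 0) -> is_series u l ->
  is_series (fun n => u (2 * n)%nat) l.
Proof.
intros H0 H.
assert (E : forall n, sum_n (fun k => u (2 * k)%nat) n = sum_n u (2 * n)).
{ intros n; induction n as [|n IH]; [now rewrite !sum_O|].
  assert (H1 := H0 n); replace (2 * n + 1)%nat with (S (2 * n)) in H1 by lia.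
  rewrite sum_Sn, IH; replace (2 * S n)%nat with (S (S (2 * n))) by lia.
  rewrite !sum_Sn, H1; f_equal; symmetry; exact (plus_zero_r _). }
apply (is_lim_seq_ext _ _ l (fun n => eq_sym (E n))).
apply (is_lim_seq_subseq (sum_n u) l (fun n => (2 * n)%nat)); [|exact H].
apply eventually_subseq; intros n; lia.
Qed.

Lemma Csums_even (u : nat -> C) (l : C) :
  (forall n, u (2 * n + 1)%nat = 0) -> Csums u l ->
  Csums (fun n => u (2 * n)%nat) l.
Proof.
intros H [H1 H2]; split.
- apply (is_series_even (fun n => Re (u n))); [intros n; now rewrite H | exact H1].
- apply (is_series_even (fun n => Im (u n))); [intros n; now rewrite H | exact H2].
Qed.

Lemma Cpow_opp (z : C) (n : nat) :
  ((- z) ^ (2 * n) = z ^ (2 * n) /\ (- z) ^ (2 * n + 1) = - z ^ (2 * n + 1))%C.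
Proof.
rewrite !Cpow_add_r, !Cpow_mult_r; simpl.
replace (- z * (- z * 1))%C with (z * (z * 1))%C by ring; split; [reflexivity|ring].
Qed.

(* Averaging the bound over [z] and [-z] leaves the even part of the series,
   a power series in [z ^ 2]; repeating this makes the tail, hence the lower
   bound, vanish. *)
Lemma mean_value_step (h : nat -> C) (r K : R) :
  0 <= r < 1 ->
  (forall z l, Cmod z = r -> Csums (fun n => h n * z ^ n)%C l -> Re l <= K) ->
  disc_coeffs h ->
  forall z l, Cmod z = r ^ 2 ->
  Csums (fun n => h (2 * n)%nat * z ^ n)%C l -> Re l <= K.
Proof.
intros Hr H Hh w l Hw Hl.
set (z := Csqrt w).
assert (Hzz : (z * z = w)%C) by apply Csqrt_sqr.
assert (Hz : Cmod z = r).
{ assert (E : Cmod z * Cmod z = r ^ 2) by (rewrite <- Cmod_mult, Hzz; exact Hw).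
  assert (0 <= Cmod z) by apply Cmod_ge_0; nra. }
assert (Hd : in_disc z) by (unfold in_disc; lra).
assert (Hz' : Cmod (- z) = r) by (rewrite Cmod_opp; exact Hz).
assert (Hd' : in_disc (- z)%C) by (unfold in_disc; lra).
assert (X := expansion_CSeries _ Hh); rewrite expansionE in X.
assert (S1 := X _ Hd); assert (S2 := X _ Hd'); cbv beta in S1, S2.
set (l1 := CSeries (fun n => h n * z ^ n)%C) in *.
set (l2 := CSeries (fun n => h n * (- z) ^ n)%C) in *.
assert (B1 := H _ _ Hz S1); assert (B2 := H _ _ Hz' S2).
assert (S3 := Csums_mult_l (RtoC (/ 2)) _ _ (Csums_plus _ _ _ _ S1 S2)).
assert (S4 : Csums (fun n => h (2 * n)%nat * w ^ n)%C (RtoC (/ 2) * (l1 + l2))%C).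
{ eapply Csums_ext; [|eapply Csums_even; [|exact S3]]; intros n; cbv beta.
  - rewrite (proj1 (Cpow_opp z n)), Cpow_mult_r.
    replace (z ^ 2)%C with w by (rewrite <- Hzz; simpl; ring).
    generalize (w ^ n)%C; intros y; rewrite RtoC_inv by lra; field.
  - rewrite (proj2 (Cpow_opp z n)); generalize (z ^ (2 * n + 1))%C; intros y; ring. }
rewrite (Csums_inj _ _ _ Hl S4), re_scal_l, re_plus; lra.
Qed.

(** Radius [r] for the even-indexed coefficients corresponds to radius [sqrt r] for [h]. *)
Lemma disc_coeffs_even (h : nat -> C) :
  disc_coeffs h -> disc_coeffs (fun n => h (2 * n)%nat).
Proof.
intros H r Hr; destruct (H (sqrt r)) as [M HM].
{ split; [apply sqrt_pos|]; rewrite <- sqrt_1; apply sqrt_lt_1; lra. }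
exists M; intros n; specialize (HM (2 * n)%nat).
rewrite pow_mult, pow2_sqrt in HM; [exact HM | lra].
Qed.

Lemma Csums_Re_lower (u : nat -> C) (l : C) (M q : R) :
  0 <= q < 1 -> u 0%nat = 0 -> (forall n, Cmod (u n) <= M * q ^ n) ->
  Csums u l -> - (M * q / (1 - q)) <= Re l.
Proof.
intros Hq H0 Hu [H _].
assert (Hq' : Rabs q < 1) by (rewrite Rabs_pos_eq; lra).
assert (G := @is_series_scal_l R_AbsRing R_NormedModule (- M) _ _ (is_series_geom q Hq')).
(* The term of rank 0 is zero; adding [- M] to it allows a comparison with the full geometric
   series. *)
assert (G' : - M * / (1 - q) <= Re l + - M).
{ apply (is_lim_seq_le (sum_n (fun n => - M * q ^ n))
           (fun n => sum_n (fun n => Re (u n)) n + - M)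
           (Finite (- M * / (1 - q))) (Finite (Re l + - M))).
  - intros n; induction n as [|n IH].
    + rewrite !sum_O, H0; simpl; lra.
    + rewrite !sum_Sn.
      change (sum_n (fun n => - M * q ^ n) n + - M * q ^ S n <=
        sum_n (fun n => Re (u n)) n + Re (u (S n)) + - M).
      assert (A := re_le_Cmod (u (S n))); apply Rabs_le_between in A.
      specialize (Hu (S n)); lra.
  - exact G.
  - apply (is_lim_seq_plus' _ _ (Re l) (- M)); [exact H | apply is_lim_seq_const]. }
replace (- (M * q / (1 - q))) with (- M * / (1 - q) + M) by (field; lra); lra.
Qed.

(** Each use of [mean_value_step] squares both [r] and [q] and keeps [M] and [K]. After [k] uses,
    the lower bound of [Csums_Re_lower] is taken at the real point of the circle. *)
Lemma Re_bound_iter (k : nat) : forall (h : nat -> C) (r K M q : R),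
  0 <= r < 1 -> 0 <= q < 1 -> h 0%nat = 0 -> disc_coeffs h ->
  (forall n, Cmod (h n) * r ^ n <= M * q ^ n) ->
  (forall z l, Cmod z = r -> Csums (fun n => h n * z ^ n)%C l -> Re l <= K) ->
  - (M * q ^ (2 ^ k) / (1 - q ^ (2 ^ k))) <= K.
Proof.
induction k as [|k IH]; intros h r K M q Hr Hq H0 Hh Hb H.
- simpl; rewrite Rmult_1_r.
  assert (Hz : Cmod r = r) by (rewrite Cmod_R, Rabs_pos_eq; lra).
  assert (X := proj1 (expansionE _ _) (expansion_CSeries _ Hh) r).
  cbv beta in X; specialize (X ltac:(unfold in_disc; lra)).
  apply Rle_trans with (2 := H _ _ Hz X).
  apply Csums_Re_lower with (4 := X); [exact Hq | rewrite H0; ring |].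
  intros n; rewrite Cmod_mult, Cmod_pow, Hz; apply Hb.
- replace (q ^ (2 ^ S k)) with ((q ^ 2) ^ (2 ^ k)) by (rewrite <- pow_mult; reflexivity).
  apply (IH (fun n => h (2 * n)%nat) (r ^ 2)).
  + simpl; nra.
  + simpl; nra.
  + exact H0.
  + now apply disc_coeffs_even.
  + intros n; rewrite <- !pow_mult; apply Hb.
  + exact (mean_value_step h r K Hr H Hh).
Qed.

(** The mean of [Re f] over the circle is [Re (h 0) = 0]. Integration is replaced by letting [k]
    tend to infinity in [Re_bound_iter]. *)
Lemma Re_bound_ge_mean (h : nat -> C) (f : C -> C) (r K : R) :
  0 <= r < 1 -> h 0%nat = 0 -> expansion f h ->
  (forall z, Cmod z = r -> Re (f z) <= K) -> 0 <= K.
Proof.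
intros Hr H0 Hf H.
assert (Hh := disc_coeffs_expansion _ _ Hf).
destruct (disc_coeffs_geom h r Hh Hr) as [M [q [Hq Hb]]].
assert (Hq' : Rabs q < 1) by (rewrite Rabs_pos_eq; lra).
assert (L0 : is_lim_seq (fun k => q ^ (2 ^ k)) 0).
{ apply (is_lim_seq_subseq (fun n => q ^ n) 0 (fun k => (2 ^ k)%nat)).
  - apply eventually_subseq; intros n; simpl.
    assert (2 ^ n <> 0)%nat by (apply Nat.pow_nonzero; lia); lia.
  - exact (is_lim_seq_geom q Hq'). }
assert (L : is_lim_seq (fun k => - (M * q ^ (2 ^ k) / (1 - q ^ (2 ^ k)))) 0).
{ replace (Finite 0) with (Finite (- (M * 0 / (1 - 0)))) by (f_equal; field).
  apply (is_lim_seq_opp _ (Finite (M * 0 / (1 - 0)))).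
  apply (is_lim_seq_div' _ _ (M * 0) (1 - 0)).
  - exact (is_lim_seq_scal_l _ M 0 L0).
  - apply is_lim_seq_minus'; [apply is_lim_seq_const | exact L0].
  - lra. }
apply (is_lim_seq_le (fun k => - (M * q ^ (2 ^ k) / (1 - q ^ (2 ^ k)))) (fun _ => K)
         (Finite 0) (Finite K)).
- intros k; apply (Re_bound_iter k h r); try assumption.
  intros z l Hz Hl.
  assert (E : l = f z).
  { apply (Csums_inj _ _ _ Hl), (proj1 (expansionE _ _) Hf); unfold in_disc; lra. }
  rewrite E; now apply H.
- exact L.
- apply is_lim_seq_const.
Qed.

(** * Coefficients of Schwarz functions *)

Lemma Cmod_sqr (z : C) : Cmod z ^ 2 = Re z * Re z + Im z * Im z.
Proof. rewrite Cmod2_alt; ring. Qed.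

(* On the circle [|z| = r] one has [Cconj z = r ^ 2 / z], so the non-constant part
   of [|alpha z + beta z ^ 2 + z ^ 3 t| ^ 2 - |1 + q z| ^ 2] is, up to the
   nonnegative [|z ^ 3 t| ^ 2], twice the real part of an analytic function. *)
Lemma circle_identity (alpha beta q t z : C) (r : R) :
  Cmod z = r ->
  2 * Re (0 + z * (Cconj beta * RtoC (r ^ 2 * r ^ 2) * t
                   + (Cconj alpha * RtoC (r ^ 2) * beta - q
                      + z * (Cconj alpha * RtoC (r ^ 2) * t))))%C =
  Cmod (alpha * z + beta * (z * z) + z * (z * z) * t)%C ^ 2
  - Cmod (1 + q * z)%C ^ 2 - Cmod t ^ 2 * (r ^ 2 * (r ^ 2 * r ^ 2))
  + (1 + Cmod q ^ 2 * r ^ 2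
     - Cmod alpha ^ 2 * r ^ 2 - Cmod beta ^ 2 * (r ^ 2 * r ^ 2)).
Proof.
intros Hr; assert (E : r ^ 2 = Re z * Re z + Im z * Im z) by (rewrite <- Hr; apply Cmod_sqr).
rewrite !Cmod_sqr, !E.
destruct alpha as [a1 a2], beta as [b1 b2], q as [q1 q2], t as [t1 t2], z as [x y].
simpl; ring.
Qed.

(** As [|omega (1 + q z)| <= |1 + q z|], [circle_identity] bounds twice the real part of a function
    vanishing at 0 by the difference of the two sides; [Re_bound_ge_mean] makes that difference
    nonnegative. *)
Lemma bounded_coeff_circle (omega : C -> C) (w : nat -> C) (q : C) (r : R) :
  expansion omega w -> w 0%nat = 0 ->
  (forall z, in_disc z -> Cmod (omega z) <= 1) -> 0 <= r < 1 ->
  Cmod (w 1%nat) ^ 2 * r ^ 2 + Cmod (w 2%nat + q * w 1%nat)%C ^ 2 * (r ^ 2 * r ^ 2)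
  <= 1 + Cmod q ^ 2 * r ^ 2.
Proof.
intros Hw H0 Hb Hr.
set (V := fun z => CSeries (fun n => w (S (S (S n))) * z ^ n)%C).
assert (HV : expansion V (fun n => w (S (S (S n))))).
{ apply expansion_CSeries.
  apply (disc_coeffs_shift_out (fun n => w (S (S n)))).
  apply (disc_coeffs_shift_out (fun n => w (S n))).
  apply disc_coeffs_shift_out, (disc_coeffs_expansion _ _ Hw). }
assert (Hom : forall z, in_disc z ->
  omega z = (w 0%nat + z * (w 1%nat + z * (w 2%nat + z * V z)))%C).
{ intros z Hz; apply (expansion_value omega
    (fun z => w 0%nat + z * (w 1%nat + z * (w 2%nat + z * V z)))%C w);
    [exact Hw | | exact Hz].
  generalize (expansion_cons (w 0%nat) _ _
    (expansion_cons (w 1%nat) _ _ (expansion_cons (w 2%nat) _ _ HV))).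
  apply expansion_ext; [reflexivity|]; intros [|[|[|n]]]; reflexivity. }
set (alpha := w 1%nat) in *; set (beta := (w 2%nat + q * alpha)%C).
(* The remainder in [omega z * (1 + q z) = alpha z + beta z^2 + z^3 T z]. *)
set (T := fun z => (V z + q * (w 2%nat + z * V z))%C).
assert (HT := expansion_plus _ _ _ _ HV
  (expansion_scal q _ _ (expansion_cons (w 2%nat) _ _ HV)) : expansion T _).
assert (HH := expansion_cons 0 _ _ (expansion_plus _ _ _ _
  (expansion_scal (Cconj beta * RtoC (r ^ 2 * r ^ 2))%C _ _ HT)
  (expansion_cons (Cconj alpha * RtoC (r ^ 2) * beta - q)%C _ _
    (expansion_scal (Cconj alpha * RtoC (r ^ 2))%C _ _ HT)))).
assert (G := fun K => Re_bound_ge_mean _ _ r K Hr eq_refl HH).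
specialize (G ((1 + Cmod q ^ 2 * r ^ 2
     - Cmod alpha ^ 2 * r ^ 2 - Cmod beta ^ 2 * (r ^ 2 * r ^ 2)) / 2)).
cut (0 <= (1 + Cmod q ^ 2 * r ^ 2
     - Cmod alpha ^ 2 * r ^ 2 - Cmod beta ^ 2 * (r ^ 2 * r ^ 2)) / 2); [lra|].
apply G; intros z Hz.
assert (Hd : in_disc z) by (unfold in_disc; lra).
assert (I := circle_identity alpha beta q (T z) z r Hz).
assert (E : (alpha * z + beta * (z * z) + z * (z * z) * T z = omega z * (1 + q * z))%C).
{ rewrite (Hom z Hd), H0; unfold T, beta; ring. }
rewrite E, Cmod_mult in I.
assert (L : (Cmod (omega z) * Cmod (1 + q * z)%C) ^ 2 <= Cmod (1 + q * z)%C ^ 2).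
{ apply pow_incr; specialize (Hb z Hd).
  assert (A1 := Cmod_ge_0 (omega z)); assert (A2 := Cmod_ge_0 (1 + q * z)%C); nra. }
assert (P : 0 <= Cmod (T z) ^ 2 * (r ^ 2 * (r ^ 2 * r ^ 2))).
{ assert (0 <= r ^ 2) by apply pow2_ge_0.
  apply Rmult_le_pos; [apply pow2_ge_0|]; apply Rmult_le_pos; nra. }
lra.
Qed.

(** This is the limit [r -> 1] of [bounded_coeff_circle], carried out with one explicit radius. *)
Lemma bounded_coeff (omega : C -> C) (w : nat -> C) (q : C) :
  expansion omega w -> w 0%nat = 0 ->
  (forall z, in_disc z -> Cmod (omega z) <= 1) ->
  Cmod (w 1%nat) ^ 2 + Cmod (w 2%nat + q * w 1%nat)%C ^ 2 <= 1 + Cmod q ^ 2.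
Proof.
intros Hw H0 Hb.
assert (H := fun r => bounded_coeff_circle omega w q r Hw H0 Hb).
set (A := Cmod (w 1%nat) ^ 2) in *; set (B := Cmod (w 2%nat + q * w 1%nat)%C ^ 2) in *.
set (D := Cmod q ^ 2) in *.
assert (HA : 0 <= A) by apply pow2_ge_0; assert (HB : 0 <= B) by apply pow2_ge_0.
destruct (Rle_dec (A + B) (1 + D)) as [|N]; [assumption|exfalso].
(* With [r^2 = 1 - e] the left side drops by at most [2 e (A + B)], less than the supposed excess
   [A + B - 1 - D = 2 e (A + B + 1)]. *)
set (e := (A + B - 1 - D) / (2 * (A + B + 1))).
assert (He : 0 < e).
{ unfold e; apply Rdiv_lt_0_compat; nra. }
assert (He2 : e * (2 * (A + B + 1)) = A + B - 1 - D) by (unfold e; field; lra).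
assert (HD : 0 <= D) by apply pow2_ge_0.
assert (e < 1) by nra.
specialize (H (sqrt (1 - e))).
rewrite pow2_sqrt in H by lra.
assert (Hs : 0 <= sqrt (1 - e) < 1).
{ split; [apply sqrt_pos|]; rewrite <- sqrt_1 at 2; apply sqrt_lt_1; lra. }
specialize (H Hs); nra.
Qed.

(* [bounded_coeff] at [q = tau * conj w_1 * w_2], optimised over real [tau]. *)
Lemma schwarz_coeff (omega : C -> C) (w : nat -> C) :
  expansion omega w -> w 0%nat = 0 ->
  (forall z, in_disc z -> Cmod (omega z) <= 1) ->
  Cmod (w 1%nat) <= 1 /\ Cmod (w 2%nat) <= 1 - Cmod (w 1%nat) ^ 2.
Proof.
intros Hw H0 Hb.
assert (H := fun q => bounded_coeff omega w q Hw H0 Hb).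
set (s := Cmod (w 1%nat)) in *.
assert (Hs : 0 <= s) by apply Cmod_ge_0.
assert (K : forall tau : R, s ^ 2 + Cmod (w 2%nat) ^ 2 * (1 + tau * s ^ 2) ^ 2
            <= 1 + tau ^ 2 * (s ^ 2 * Cmod (w 2%nat) ^ 2)).
{ intros tau; specialize (H (RtoC tau * (Cconj (w 1%nat) * w 2%nat))%C).
  rewrite !Cmod_mult, Cmod_conj, Cmod_R in H; fold s in H.
  replace (w 2%nat + tau * (Cconj (w 1%nat) * w 2%nat) * w 1%nat)%C
    with (w 2%nat * RtoC (1 + tau * s ^ 2))%C in H.
  - rewrite Cmod_mult, Cmod_R, !Rpow_mult_distr, !pow2_abs in H; exact H.
  - unfold s; rewrite RtoC_plus, RtoC_mult, Cmod2_conj; ring. }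
assert (Hm := Cmod_ge_0 (w 2%nat)); set (m := Cmod (w 2%nat)) in *.
assert (S1 : s <= 1) by (specialize (K 0); nra).
split; [exact S1|].
destruct (Req_dec s 1) as [E|N].
- assert (m = 0); [|nra].
  destruct (Req_dec m 0) as [|M]; [assumption|exfalso].
  (* For [s = 1] the optimal [tau] is infinite, but [tau = 1] suffices: [1 + 4 m^2 <= 1 + m^2]. *)
  specialize (K 1); rewrite E in K; nra.
- assert (P : 0 < 1 - s ^ 2) by nra.
  (* This [tau] maximises [(1 + tau s^2)^2 - tau^2 s^2], the factor of [m^2]; the maximum [Y] equals
     [1 / (1 - s^2)]. *)
  specialize (K (/ (1 - s ^ 2))).
  assert (Q : m ^ 2 <= (1 - s ^ 2) ^ 2).
  { assert (I : (1 - s ^ 2) * ((1 + / (1 - s ^ 2) * s ^ 2) ^ 2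
                 - (/ (1 - s ^ 2)) ^ 2 * s ^ 2) = 1) by (field; lra).
    set (Y := (1 + / (1 - s ^ 2) * s ^ 2) ^ 2 - (/ (1 - s ^ 2)) ^ 2 * s ^ 2) in *.
    assert (K' : m ^ 2 * Y <= 1 - s ^ 2) by (unfold Y; lra).
    assert (HY : 0 < Y) by (apply Rnot_le_lt; intros N2; nra).
    apply Rmult_le_reg_r with Y; [exact HY|].
    replace ((1 - s ^ 2) ^ 2 * Y) with ((1 - s ^ 2) * ((1 - s ^ 2) * Y)) by ring.
    rewrite I; lra. }
  apply Rsqr_incr_0_var; [unfold Rsqr; lra | lra].
Qed.

(** By [schwarz_coeff] the modulus is at most [(1 - s^2) + |t| s^2] with [s = |w_1| <= 1], a convex
    combination of [1] and [|t|]. *)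
Lemma schwarz_fekete_szego (omega : C -> C) (w : nat -> C) (t : R) :
  expansion omega w -> w 0%nat = 0 ->
  (forall z, in_disc z -> Cmod (omega z) <= 1) ->
  Cmod (w 2%nat - RtoC t * w 1%nat ^ 2)%C <= Rmax 1 (Rabs t).
Proof.
intros Hw H0 Hb; destruct (schwarz_coeff omega w Hw H0 Hb) as [H1 H2].
apply Rle_trans with (Cmod (w 2%nat) + Rabs t * Cmod (w 1%nat) ^ 2).
- unfold Cminus; apply Rle_trans with (1 := Cmod_triangle _ _).
  rewrite Cmod_opp, Cmod_mult, Cmod_R, Cmod_pow; lra.
- assert (A := Rmax_l 1 (Rabs t)); assert (B := Rmax_r 1 (Rabs t)).
  assert (C1 := Cmod_ge_0 (w 1%nat)).
  set (s := Cmod (w 1%nat)) in *; set (X := Rmax 1 (Rabs t)) in *.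
  assert (0 <= 1 - s ^ 2) by nra; assert (0 <= s ^ 2) by apply pow2_ge_0.
  assert (0 <= (X - 1) * (1 - s ^ 2)) by nra.
  assert (0 <= (X - Rabs t) * s ^ 2) by nra; nra.
Qed.

(** * The binomial series of the square root *)

(* [inv_sqrt_coeff n] is the coefficient of [x ^ n] in [(1 - x) ^ (-1/2)], and the
   partial sums of [(1 - x) ^ (1/2)] at [x = 1]. *)
Fixpoint inv_sqrt_coeff (n : nat) : R :=
  match n with
  | O => 1
  | S m => inv_sqrt_coeff m * ((2 * INR m + 1) / (2 * INR m + 2))
  end.

(* The coefficient of [x ^ n] in [(1 + x) ^ (1/2)]. *)
Definition sqrt_coeff (n : nat) : R :=
  match n with
  | O => 1
  | S m => (-1) ^ m * inv_sqrt_coeff m / (2 * (INR m + 1))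
  end.

(** The recurrence of the binomial coefficients of exponent 1/2, that is [(1 + x) y' = y / 2] read
    on coefficients. *)
Lemma sqrt_coeff_S (n : nat) :
  (INR n + 1) * sqrt_coeff (S n) = (1 / 2 - INR n) * sqrt_coeff n.
Proof.
destruct n as [|m].
- simpl; field.
- assert (0 <= INR m) by apply pos_INR.
  unfold sqrt_coeff; simpl inv_sqrt_coeff; rewrite S_INR; simpl pow; field; lra.
Qed.

Lemma inv_sqrt_coeff_bounds (n : nat) : 0 <= inv_sqrt_coeff n <= 1.
Proof.
induction n as [|n IH]; simpl; [lra|].
assert (0 <= INR n) by apply pos_INR.
assert (0 <= (2 * INR n + 1) / (2 * INR n + 2)) by (apply Rdiv_le_0_compat; lra).
assert ((2 * INR n + 1) / (2 * INR n + 2) <= 1) by (apply Rle_div_l; lra).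
nra.
Qed.

Lemma sqrt_coeff_abs (n : nat) :
  Rabs (sqrt_coeff (S n)) = inv_sqrt_coeff n - inv_sqrt_coeff (S n).
Proof.
assert (Hn := pos_INR n); assert (H := inv_sqrt_coeff_bounds n).
simpl; unfold Rdiv; rewrite !Rabs_mult, pow_1_abs, Rabs_inv.
rewrite (Rabs_pos_eq (inv_sqrt_coeff n)), (Rabs_pos_eq (2 * _)) by lra.
field; lra.
Qed.

Lemma sqrt_coeff_le1 (n : nat) : Rabs (sqrt_coeff n) <= 1.
Proof.
destruct n as [|n]; [simpl; rewrite Rabs_pos_eq; lra|].
rewrite sqrt_coeff_abs.
generalize (inv_sqrt_coeff_bounds n) (inv_sqrt_coeff_bounds (S n)); lra.
Qed.

(* The Cauchy square of [sqrt_coeff]; differentiating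
   [((1 + x) ^ (1/2)) ^ 2] suggests the recurrence [sqrt_conv_S]. *)
Definition sqrt_conv (n : nat) : R :=
  sum_f_R0 (fun k => sqrt_coeff k * sqrt_coeff (n - k)) n.

Lemma sqrt_conv_S (n : nat) : (INR n + 1) * sqrt_conv (S n) = (1 - INR n) * sqrt_conv n.
Proof.
(* The product rule: the weight [n + 1] is split as [k + (n + 1 - k)], one part for each factor. *)
set (F := fun k => INR k * sqrt_coeff k * sqrt_coeff (S n - k)).
set (G := fun k => sqrt_coeff k * (INR (S n - k) * sqrt_coeff (S n - k))).
assert (E : (INR n + 1) * sqrt_conv (S n) = sum_f_R0 F (S n) + sum_f_R0 G (S n)).
{ unfold sqrt_conv; rewrite scal_sum, <- plus_sum; apply sum_eq; intros k Hk.
  unfold F, G; rewrite minus_INR, S_INR by lia; ring. }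
assert (F0 : sum_f_R0 F (S n) = sum_f_R0 (fun k => F (S k)) n).
{ rewrite decomp_sum by lia; unfold F at 1; simpl; ring. }
assert (G0 : sum_f_R0 G (S n) = sum_f_R0 G n).
{ rewrite tech5; unfold G at 2; rewrite Nat.sub_diag; simpl; ring. }
rewrite E, F0, G0, <- plus_sum; unfold sqrt_conv; rewrite scal_sum.
apply sum_eq; intros k Hk; unfold F, G.
replace (S n - S k)%nat with (n - k)%nat by lia.
replace (S n - k)%nat with (S (n - k)) by lia.
(* The weights combine to [(1/2 - k) + (1/2 - (n - k)) = 1 - n]. *)
rewrite !S_INR, !sqrt_coeff_S, minus_INR by lia; field.
Qed.

(** The factor [1 - n] of the recurrence vanishes at [n = 1], and the zero then propagates. *)
Lemma sqrt_conv_val (n : nat) : sqrt_conv n = match n with O | 1%nat => 1 | _ => 0 end.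
Proof.
assert (H1 : sqrt_conv 1 = 1) by (unfold sqrt_conv; simpl; field).
destruct n as [|[|n]]; [unfold sqrt_conv; simpl; ring | exact H1 |].
induction n as [|n IH].
- generalize (sqrt_conv_S 1); rewrite H1; simpl; lra.
- generalize (sqrt_conv_S (S (S n))) (pos_INR (S (S n))); rewrite IH; intros E P.
  apply Rmult_eq_reg_l with (INR (S (S n)) + 1); lra.
Qed.

Definition sqrt_series (z : C) : C := CSeries (fun n => RtoC (sqrt_coeff n) * z ^ n)%C.

Lemma disc_coeffs_bounded (p : nat -> C) :
  (forall n, Cmod (p n) <= 1) -> disc_coeffs p.
Proof.
intros H r Hr; exists 1; intros n.
assert (0 <= r ^ n) by (apply pow_le; lra).
assert (r ^ n <= 1) by (rewrite <- (pow1 n); apply pow_incr; lra).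
generalize (H n) (Cmod_ge_0 (p n)); nra.
Qed.

Lemma expansion_sqrt_series : expansion sqrt_series (fun n => RtoC (sqrt_coeff n)).
Proof.
apply expansion_CSeries, disc_coeffs_bounded; intros n.
rewrite Cmod_R; apply sqrt_coeff_le1.
Qed.

Lemma expansion_0 : expansion (fun _ => RtoC 0) (fun _ => RtoC 0).
Proof.
generalize (expansion_scal 0 _ _ expansion_sqrt_series).
apply expansion_ext; intros; ring.
Qed.

Lemma sqrt_series_sqr (z : C) : in_disc z -> (sqrt_series z * sqrt_series z = 1 + z)%C.
Proof.
intros Hz.
assert (H := expansion_mult _ _ _ _ expansion_sqrt_series expansion_sqrt_series).
assert (K := expansion_cons 1 _ _ (expansion_cons 1 _ _ expansion_0)).
(* The nested form lets [expansion_cons] read off the coefficients 1, 1, 0, 0, ... *)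
transitivity (1 + z * (1 + z * 0))%C; [|ring].
apply (expansion_value (fun z => sqrt_series z * sqrt_series z)%C
  (fun z => 1 + z * (1 + z * 0))%C _ z H); [|exact Hz].
revert K; apply expansion_ext; [reflexivity|]; intros n.
apply C_eq; simpl.
- transitivity (sqrt_conv n).
  + rewrite sqrt_conv_val; destruct n as [|[|n]]; reflexivity.
  + apply sum_eq; intros k Hk; simpl; ring.
- transitivity (sum_f_R0 (fun _ => 0) n).
  + rewrite sum_eq_R0 by reflexivity; destruct n as [|[|n]]; reflexivity.
  + apply sum_eq; intros k Hk; simpl; ring.
Qed.

(* [|sqrt_coeff (n+1)|] telescopes, so the real part of each partial sum is at least
   [1 - (|sqrt_coeff 1| + ... + |sqrt_coeff n|) = inv_sqrt_coeff n]. *)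
Lemma sqrt_series_Re_ge0 (z : C) : in_disc z -> 0 <= Re (sqrt_series z).
Proof.
intros Hz; destruct (proj1 (expansionE _ _) expansion_sqrt_series z Hz) as [H _].
apply (is_lim_seq_le (fun _ => 0)
  (sum_n (fun n => Re (RtoC (sqrt_coeff n) * z ^ n)%C)) (Finite 0) (Finite (Re (sqrt_series z)))).
- intros n; apply Rle_trans with (inv_sqrt_coeff n); [apply inv_sqrt_coeff_bounds|].
  induction n as [|n IH]; [rewrite sum_O; simpl; lra|].
  rewrite sum_Sn.
  change (inv_sqrt_coeff (S n) <=
    sum_n (fun n => Re (RtoC (sqrt_coeff n) * z ^ n)%C) n
    + Re (RtoC (sqrt_coeff (S n)) * z ^ S n)%C).
  assert (A := re_le_Cmod (RtoC (sqrt_coeff (S n)) * z ^ S n)%C).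
  rewrite Cmod_mult, Cmod_R, Cmod_pow, sqrt_coeff_abs in A.
  apply Rabs_le_between in A.
  assert (0 <= Cmod z ^ S n <= 1).
  { assert (P := Cmod_ge_0 z); split; [now apply pow_le|].
    rewrite <- (pow1 (S n)); apply pow_incr; unfold in_disc in Hz; lra. }
  assert (Q := Rabs_pos (sqrt_coeff (S n))); rewrite sqrt_coeff_abs in Q.
  nra.
- apply is_lim_seq_const.
- exact H.
Qed.

(** In [(u - v) (u + v) = 0] the second factor has positive real part, since [Re (u^2) > 0] excludes
    [Re u = 0]. *)
Lemma Csqr_inj (u v : C) :
  (u * u = v * v)%C -> 0 < Re (u * u)%C -> 0 <= Re u -> 0 <= Re v -> u = v.
Proof.
intros E P Hu Hv.
assert (Hu' : 0 < Re u) by (rewrite re_mult in P; nra).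
assert (N : (u + v)%C <> 0).
{ intros Z; assert (B : Re (u + v)%C = 0) by now rewrite Z.
  rewrite re_plus in B; lra. }
destruct (Ceq_dec (u - v)%C 0) as [D|D].
- replace u with (u - v + v)%C by ring; rewrite D; ring.
- exfalso; apply (Cmult_neq_0 _ _ D N).
  replace ((u - v) * (u + v))%C with (u * u - v * v)%C by ring; rewrite E; ring.
Qed.

(** Both sides are square roots of [1 + z] in the closed right half-plane, and [Re (1 + z) > 0]
    leaves only one such root. *)
Lemma Csqrt_series (z : C) : in_disc z -> sqrt_series z = Csqrt (1 + z)%C.
Proof.
intros Hz; assert (E := sqrt_series_sqr z Hz); apply Csqr_inj.
- now rewrite E, Csqrt_sqr.
- rewrite E, re_plus, re_RtoC.
  assert (A := re_le_Cmod z); apply Rabs_le_between in A; unfold in_disc in Hz; lra.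
- now apply sqrt_series_Re_ge0.
- apply Csqrt_Re_ge0.
Qed.

(** The coefficients of [f (z^2)] when [f] has coefficients [p]. *)
Definition even_coeff (p : nat -> C) (n : nat) : C :=
  if Nat.even n then p (Nat.div2 n) else 0.

Lemma expansion_Csqrt_sqr :
  expansion (fun z => Csqrt (1 + z ^ 2)%C) (even_coeff (fun n => RtoC (sqrt_coeff n))).
Proof.
assert (H : disc_coeffs (even_coeff (fun n => RtoC (sqrt_coeff n)))).
{ apply disc_coeffs_bounded; intros n; unfold even_coeff; destruct (Nat.even n).
  - rewrite Cmod_R; apply sqrt_coeff_le1.
  - rewrite Cmod_0; lra. }
assert (K := expansion_CSeries _ H); revert K; apply expansion_ext; [|reflexivity].
assert (K := proj1 (expansionE _ _) (expansion_CSeries _ H)); cbv beta in K.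
intros z Hz.
assert (Hz2 : in_disc (z ^ 2)%C).
{ unfold in_disc in *; rewrite Cmod_pow; assert (P := Cmod_ge_0 z); simpl; nra. }
rewrite <- Csqrt_series by exact Hz2.
apply Csums_inj with (2 := proj1 (expansionE _ _) expansion_sqrt_series _ Hz2).
eapply Csums_ext; [|eapply Csums_even; [|exact (K z Hz)]]; intros n; cbv beta;
  unfold even_coeff.
- rewrite Nat.even_even, Nat.div2_double, Cpow_mult_r; reflexivity.
- rewrite Nat.even_odd; ring.
Qed.

(** The sum [g] of the series satisfies [g = 1 - z g] by uniqueness of sums, and this is solved for
    [g]. *)
Lemma expansion_inv_1_plus :
  expansion (fun z => / (1 + z))%C (fun n => RtoC ((-1) ^ n)).
Proof.
set (p := fun n => RtoC ((-1) ^ n)).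
assert (H : disc_coeffs p).
{ apply disc_coeffs_bounded; intros n; unfold p; rewrite Cmod_R, pow_1_abs; lra. }
assert (K := expansion_CSeries _ H); revert K; apply expansion_ext; [|reflexivity].
assert (K := expansion_CSeries _ H); intros z Hz.
set (g := fun z => CSeries (fun n => p n * z ^ n)%C) in *; change (g z = / (1 + z))%C.
assert (E : g z = (1 + z * (-1 * g z))%C).
{ apply (expansion_value g (fun z => 1 + z * (-1 * g z))%C p z K); [|exact Hz].
  generalize (expansion_cons 1 _ _ (expansion_scal (-1) _ _ K)).
  apply expansion_ext; [reflexivity|]; intros [|n]; [reflexivity|].
  unfold p; simpl; now rewrite RtoC_mult. }
assert (N : (1 + z)%C <> 0).
{ intros Z; assert (A := re_le_Cmod z); apply Rabs_le_between in A.
  assert (B : Re (1 + z)%C = 0) by now rewrite Z.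
  rewrite re_plus, re_RtoC in B; unfold in_disc in Hz; lra. }
replace (g z) with (g z * (1 + z) / (1 + z))%C by (field; exact N).
replace (g z * (1 + z))%C with (RtoC 1); [field; exact N|].
transitivity (g z - z * (-1 * g z))%C; [rewrite E at 1|]; ring.
Qed.

(** * Hypergeometric coefficients and the Fekete-Szego functional *)

(** A ratio test: consecutive ratios are at most [1 + K / (n + 1)], so [u n * r ^ n] is eventually
    nonincreasing for every [r < 1]. *)
Lemma disc_coeffs_growth (u : nat -> R) (K : R) :
  0 <= K -> (forall n, 0 <= u n) ->
  (forall n, u (S n) * (INR n + 1) <= u n * (INR n + 1 + K)) ->
  disc_coeffs (fun n => RtoC (u n)).
Proof.
intros HK Hu Hg r Hr.
(* From this rank on, [(n + 1 + K) r <= n + 1]. *)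
destruct (INR_unbounded (K * r / (1 - r))) as [N HN].
assert (HN' : K * r < INR N * (1 - r)) by (apply Rlt_div_l; lra).
set (v := fun n => Cmod (RtoC (u n)) * r ^ n).
assert (Hv : forall n, v n = u n * r ^ n).
{ intros n; unfold v; rewrite Cmod_R, Rabs_pos_eq by apply Hu; reflexivity. }
assert (Hv0 : forall n, 0 <= v n).
{ intros n; rewrite Hv; apply Rmult_le_pos; [apply Hu | apply pow_le; lra]. }
assert (Hdec : forall m, v (N + S m)%nat <= v (N + m)%nat).
{ intros m; rewrite !Hv, Nat.add_succ_r; set (n := (N + m)%nat); simpl.
  assert (Hn : INR N <= INR n) by (apply le_INR; unfold n; lia).
  assert (H0 := pos_INR N); specialize (Hg n).
  assert (R1 : u (S n) * r * (INR n + 1) <= u n * (INR n + 1)).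
  { apply Rle_trans with (u n * ((INR n + 1 + K) * r)); [nra|].
    apply Rmult_le_compat_l; [apply Hu | nra]. }
  assert (R2 : u (S n) * r <= u n) by (apply Rmult_le_reg_r with (INR n + 1); lra).
  assert (0 <= r ^ n) by (apply pow_le; lra); nra. }
assert (Htail : forall m, v (N + m)%nat <= v N).
{ induction m as [|m IH]; [rewrite Nat.add_0_r; lra|].
  apply Rle_trans with (2 := IH), Hdec. }
(* The sum of the first terms serves as an upper bound for their maximum. *)
assert (Hsum : forall k n, (n <= k)%nat -> v n <= sum_f_R0 v k).
{ induction k as [|k IH]; intros n Hn.
  - replace n with 0%nat by lia; simpl; lra.
  - simpl; destruct (Nat.eq_dec n (S k)) as [->|Hne].
    + assert (0 <= sum_f_R0 v k) by (apply cond_pos_sum; exact Hv0); lra.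
    + specialize (IH n ltac:(lia)); specialize (Hv0 (S k)); lra. }
exists (sum_f_R0 v N); intros n; change (v n <= sum_f_R0 v N).
destruct (Nat.le_gt_cases n N) as [L|L]; [now apply Hsum|].
replace n with (N + (n - N))%nat by lia.
apply Rle_trans with (1 := Htail _), Hsum; lia.
Qed.

Lemma pochhammer_pos (x : R) (n : nat) : 0 < x -> 0 < pochhammer x n.
Proof.
intros Hx; induction n as [|n IH]; simpl; [lra|].
generalize (pos_INR n); nra.
Qed.

Lemma expansion_hyp2F1 (a b c : R) : 0 < c -> c <= a -> c <= b ->
  expansion (hyp2F1 a b c) (fun n => RtoC
    (pochhammer a n * pochhammer b n / (pochhammer c n * INR (fact n)))).
Proof.
intros hc hac hbc; apply expansion_CSeries.
(* With [x = (b + n) / (c + n) <= b / c], the ratio times [n + 1] is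
   [(a + n) x = b + n + (a - c) x]. *)
apply (disc_coeffs_growth _ (b + (a - c) * (b / c))).
- assert (0 <= b / c) by (apply Rdiv_le_0_compat; lra); nra.
- intros n; apply Rdiv_le_0_compat.
  + apply Rmult_le_pos; apply Rlt_le, pochhammer_pos; lra.
  + apply Rmult_lt_0_compat; [apply pochhammer_pos; lra | apply INR_fact_lt_0].
- intros n; rewrite fact_simpl, mult_INR, S_INR; simpl.
  assert (Pa := pochhammer_pos a n ltac:(lra)).
  assert (Pb := pochhammer_pos b n ltac:(lra)).
  assert (Pc := pochhammer_pos c n hc).
  assert (Pf := INR_fact_lt_0 n); assert (Pn := pos_INR n).
  set (u := pochhammer a n * pochhammer b n / (pochhammer c n * INR (fact n))).
  assert (Pu : 0 <= u).
  { apply Rdiv_le_0_compat; [|now apply Rmult_lt_0_compat].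
    apply Rmult_le_pos; lra. }
  replace (_ * (INR n + 1)) with (u * ((a + INR n) * ((b + INR n) / (c + INR n))))
    by (unfold u; field; repeat split; lra).
  apply Rmult_le_compat_l; [exact Pu|].
  assert (Q : (b + INR n) / (c + INR n) <= b / c).
  { apply Rle_div_l; [lra|]; apply Rmult_le_reg_r with c; [lra|].
    replace (b / c * (c + INR n) * c) with (b * (c + INR n)) by (field; lra); nra. }
  replace ((a + INR n) * ((b + INR n) / (c + INR n)))
    with (b + INR n + (a - c) * ((b + INR n) / (c + INR n))) by (field; lra).
  nra.
Qed.

Lemma expansion_hyp1F2 (a b c : R) : 0 < c -> c <= a -> c <= b ->
  expansion (hyp1F2 c b a) (fun n => RtoC
    (pochhammer c n / (pochhammer b n * pochhammer a n * INR (fact n)))).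
Proof.
intros hc hac hbc; apply expansion_CSeries.
(* The ratio times [n + 1] is [(c + n) / ((a + n) (b + n)) <= 1 / a]. *)
apply (disc_coeffs_growth _ (/ a)).
- apply Rlt_le, Rinv_0_lt_compat; lra.
- intros n; apply Rdiv_le_0_compat; [apply Rlt_le, pochhammer_pos; lra|].
  apply Rmult_lt_0_compat; [|apply INR_fact_lt_0].
  apply Rmult_lt_0_compat; apply pochhammer_pos; lra.
- intros n; rewrite fact_simpl, mult_INR, S_INR; simpl.
  assert (Pa := pochhammer_pos a n ltac:(lra)).
  assert (Pb := pochhammer_pos b n ltac:(lra)).
  assert (Pc := pochhammer_pos c n hc).
  assert (Pf := INR_fact_lt_0 n); assert (Pn := pos_INR n).
  set (u := pochhammer c n / (pochhammer b n * pochhammer a n * INR (fact n))).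
  assert (Pu : 0 <= u).
  { apply Rdiv_le_0_compat; [lra|]; repeat apply Rmult_lt_0_compat; assumption. }
  replace (_ * (INR n + 1)) with (u * (/ (a + INR n) * ((c + INR n) / (b + INR n))))
    by (unfold u; field; repeat split; lra).
  apply Rmult_le_compat_l; [exact Pu|].
  assert (Q1 : (c + INR n) / (b + INR n) <= 1) by (apply Rle_div_l; lra).
  assert (Q2 : / (a + INR n) <= / a) by (apply Rinv_le_contravar; lra).
  assert (Q3 : 0 < / (a + INR n)) by (apply Rinv_0_lt_compat; lra).
  nra.
Qed.

Definition fs_scale (a b c : R) : R :=
  pochhammer c 2 / (pochhammer a 2 * pochhammer b 2).

(** With [phi_n] the coefficients of [hyp2F1], this is [t = (1 + 2 mu phi_2 / phi_1^2) / 4], and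
    [fs_scale] is [K = 1 / (2 phi_2)]. *)
Definition fs_param (a b c mu : R) : R :=
  (1 + mu * (c * (a + 1) * (b + 1) / (a * b * (c + 1)))) / 4.

Lemma fs_scale_pos (a b c : R) : 0 < c -> c <= a -> c <= b -> 0 < fs_scale a b c.
Proof.
intros; apply Rdiv_lt_0_compat; [apply pochhammer_pos; lra|].
apply Rmult_lt_0_compat; apply pochhammer_pos; lra.
Qed.

(** The values [k = -5] and [k = 3] correspond to [t = -1] and [t = 1]. *)
Lemma mu_threshold (a b c mu k : R) : 0 < c -> c <= a -> c <= b ->
  (mu < k * (c + 1) * a * b / (c * (a + 1) * (b + 1))
   <-> mu * (c * (a + 1) * (b + 1) / (a * b * (c + 1))) < k).
Proof.
intros hc hac hbc.
assert (P1 : 0 < c * (a + 1) * (b + 1)) by (repeat apply Rmult_lt_0_compat; lra).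
assert (P2 : 0 < a * b * (c + 1)) by (repeat apply Rmult_lt_0_compat; lra).
set (Y := c * (a + 1) * (b + 1) / (a * b * (c + 1))).
assert (PY : 0 < Y) by now apply Rdiv_lt_0_compat.
replace (k * (c + 1) * a * b / (c * (a + 1) * (b + 1))) with (k / Y)
  by (unfold Y; field; repeat split; lra).
apply iff_sym, Rlt_div_r; exact PY.
Qed.

Lemma mu_lowE (a b c mu : R) : 0 < c -> c <= a -> c <= b ->
  (mu < mu_low a b c <-> fs_param a b c mu < -1).
Proof.
intros hc hac hbc; assert (H := mu_threshold a b c mu (-5) hc hac hbc).
fold (mu_low a b c) in H; unfold fs_param; lra.
Qed.

Lemma mu_highE (a b c mu : R) : 0 < c -> c <= a -> c <= b ->
  (mu <= mu_high a b c <-> fs_param a b c mu <= 1).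
Proof.
(* The signs are reversed so that negating the strict equivalence gives the non-strict one. *)
intros hc hac hbc; assert (H := mu_threshold a b c (- mu) (-3) hc hac hbc).
replace (-3 * (c + 1) * a * b / (c * (a + 1) * (b + 1))) with (- mu_high a b c) in H
  by (unfold mu_high; field; repeat split; lra).
unfold fs_param; lra.
Qed.

Lemma fs_boundE (a b c mu : R) : 0 < c -> c <= a -> c <= b ->
  fs_bound a b c mu = fs_scale a b c * Rmax 1 (Rabs (fs_param a b c mu)).
Proof.
intros hc hac hbc; unfold fs_bound.
assert (L := mu_lowE a b c mu hc hac hbc); assert (U := mu_highE a b c mu hc hac hbc).
destruct (Rlt_dec mu (mu_low a b c)) as [H1|H1];
  [|destruct (Rle_dec mu (mu_high a b c)) as [H2|H2]].
- rewrite Rabs_left, Rmax_right by (try rewrite Rabs_left; lra).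
  unfold fs_scale, fs_param; simpl; field; repeat split; lra.
- rewrite Rmax_left; [unfold fs_scale; ring|]; apply Rabs_le; lra.
- rewrite Rabs_pos_eq, Rmax_right by lra.
  unfold fs_scale, fs_param; simpl; field; repeat split; lra.
Qed.

Lemma fekete_szego_upper (a b c mu : R) (f : C -> C) (ak : nat -> C) :
  0 < c -> c <= a -> c <= b -> class_R a b c f -> expansion f ak ->
  Cmod (ak 3%nat - RtoC mu * ak 2%nat ^ 2)%C <= fs_bound a b c mu.
Proof.
intros hc hac hbc [[_ [p [Hp0 [Hp1 Hp]]]] [omega [_ [Ho0 [Ho1 Ho]]]]] Hf.
assert (Hak1 : ak 1%nat = 1) by now rewrite <- Hp1; apply (expansion_unique f).
set (phi := fun n => pochhammer a n * pochhammer b n / (pochhammer c n * INR (fact n))).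
assert (HF := expansion_cons 0 _ _ (expansion_hyp2F1 a b c hc hac hbc)).
fold phi in HF.
set (g := hohlov a b c f) in *.
(* The coefficients of [g z / z]. *)
set (h := fun n => (RtoC (phi n) * ak (S n))%C).
assert (HF' : expansion (fun z => z * hyp2F1 a b c z)%C
                        (shift_in 0 (fun n => RtoC (phi n)))).
{ revert HF; apply expansion_ext; [intros; ring | reflexivity]. }
assert (Hg : expansion g (shift_in 0 h)).
{ generalize (expansion_hadamard _ _ _ _ HF' Hf).
  apply expansion_ext; [reflexivity|]; intros [|n]; simpl; [ring | reflexivity]. }
assert (Hh : disc_coeffs h).
{ exact (disc_coeffs_shift_out _ (disc_coeffs_expansion _ _ Hg)). }
set (G := fun z => CSeries (fun n => h n * z ^ n)%C).
assert (HG : expansion G h) by exact (expansion_CSeries h Hh).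
assert (h0 : h 0%nat = 1).
{ unfold h, phi; rewrite Hak1; simpl.
  replace (1 * 1 / (1 * 1)) with 1 by field; ring. }
(* At the origin both sides vanish because [h 0 = 1] and [omega 0 = 0], so the limit inside
   [quot_id] is never computed. *)
assert (Hsq : forall z, in_disc z -> (-1 + G z * G z)%C = omega z).
{ intros z Hz; destruct (Ceq_dec z 0) as [->|Hz0].
  - rewrite Ho0, (expansion_at_0 _ _ HG), h0; ring.
  - assert (E := Ho z Hz); unfold quot_id in E.
    destruct (Ceq_dec z 0) as [|_]; [contradiction|].
    assert (Eg : g z = (0 + z * G z)%C).
    { apply (expansion_value g (fun z => 0 + z * G z)%C _ z Hg); [|exact Hz].
      exact (expansion_cons 0 _ _ HG). }
    assert (EG : G z = Csqrt (1 + omega z)%C).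
    { rewrite <- E, Eg; field; exact Hz0. }
    rewrite EG, Csqrt_sqr; ring. }
set (w := fun n => (shift_in (-1) (fun _ => RtoC 0) n + Cconv h h n)%C).
assert (Hw : expansion omega w).
{ generalize (expansion_plus _ _ _ _ (expansion_cons (-1) _ _ expansion_0)
                (expansion_mult _ _ _ _ HG HG)).
  apply expansion_ext; [|reflexivity].
  intros z Hz; rewrite <- (Hsq z Hz); ring. }
assert (w0 : w 0%nat = 0).
{ rewrite <- (expansion_at_0 _ _ Hw); exact Ho0. }
assert (w1 : w 1%nat = (2 * h 1%nat)%C).
{ unfold w; transitivity (h 0%nat * h 1%nat + h 1%nat * h 0%nat)%C.
  - apply C_eq; simpl; ring.
  - rewrite h0; ring. }
assert (w2 : w 2%nat = (2 * h 2%nat + h 1%nat * h 1%nat)%C).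
{ unfold w; transitivity (h 0%nat * h 2%nat + h 1%nat * h 1%nat + h 2%nat * h 0%nat)%C.
  - apply C_eq; simpl; ring.
  - rewrite h0; ring. }
set (K := fs_scale a b c); set (t := fs_param a b c mu).
assert (Hpos : forall x n, c <= x -> pochhammer x n <> 0).
{ intros x n Hx; apply Rgt_not_eq, pochhammer_pos; lra. }
(* Since [w_2 - t w_1^2 = 2 h_2 + (1 - 4 t) h_1^2], the identities [K1] and [K2] match the
   coefficients of [a_3] and [a_2^2]. *)
assert (K1 : K * (2 * phi 2%nat) = 1).
{ unfold K, fs_scale, phi; simpl INR; field.
  repeat split; try (apply Hpos; lra); simpl; lra. }
assert (K2 : K * ((1 - 4 * t) * (phi 1%nat * phi 1%nat)) = - mu).
{ unfold K, t, fs_scale, fs_param, phi; simpl; field; repeat split; lra. }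
assert (E : (ak 3%nat - RtoC mu * ak 2%nat ^ 2 = RtoC K * (w 2%nat - RtoC t * w 1%nat ^ 2))%C).
{ transitivity (RtoC (K * (2 * phi 2%nat)) * ak 3%nat
    + RtoC (K * ((1 - 4 * t) * (phi 1%nat * phi 1%nat))) * ak 2%nat ^ 2)%C.
  - rewrite K1, K2, RtoC_opp; ring.
  - rewrite w1, w2; unfold h.
    rewrite !RtoC_mult, RtoC_minus, RtoC_mult; simpl; ring. }
assert (KP := fs_scale_pos a b c hc hac hbc); fold K in KP.
rewrite E, Cmod_mult, Cmod_R, Rabs_pos_eq, fs_boundE by lra.
apply Rmult_le_compat_l; [fold K; lra|].
apply (schwarz_fekete_szego omega w t Hw w0).
intros z Hz; apply Rlt_le, Ho1, Hz.
Qed.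

(** From [4 z sqrt (1 + z^2) = 4 z + 2 z^3 + ...] one gets [a_2 = 0] and [a_3 = K], whatever [mu]
    is. *)
Lemma fekete_szego_mid (a b c mu : R) : 0 < c -> c <= a -> c <= b ->
  exists ak : nat -> C, expansion (extremal_mid a b c) ak /\
    Cmod (ak 3%nat - RtoC mu * ak 2%nat ^ 2)%C = fs_scale a b c.
Proof.
intros hc hac hbc; eexists; split.
- apply expansion_hadamard.
  + generalize (expansion_cons 0 _ _ (expansion_hyp1F2 a b c hc hac hbc)).
    apply expansion_ext; [intros; ring | reflexivity].
  + generalize (expansion_cons 0 _ _ (expansion_scal 4 _ _ expansion_Csqrt_sqr)).
    apply expansion_ext; [intros; ring | reflexivity].
- assert (KP := fs_scale_pos a b c hc hac hbc).
  rewrite <- (Rabs_pos_eq (fs_scale a b c)), <- Cmod_R by lra; f_equal.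
  apply C_eq; simpl; [|ring]; unfold fs_scale; simpl; field; lra.
Qed.

Lemma fekete_szego_out (a b c mu : R) : 0 < c -> c <= a -> c <= b ->
  exists ak : nat -> C, expansion (extremal_out a b c) ak /\
    Cmod (ak 3%nat - RtoC mu * ak 2%nat ^ 2)%C
    = fs_scale a b c * Rabs (fs_param a b c mu).
Proof.
intros hc hac hbc; eexists; split.
- apply expansion_hadamard.
  + generalize (expansion_cons 0 _ _ (expansion_hyp1F2 a b c hc hac hbc)).
    apply expansion_ext; [intros; ring | reflexivity].
  + generalize (expansion_cons 0 _ _ (expansion_scal (RtoC (- / 2)) _ _ expansion_inv_1_plus)).
    apply expansion_ext; [|reflexivity].
    intros z Hz; rewrite RtoC_opp, RtoC_inv by lra; unfold Cdiv; ring.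
- assert (KP := fs_scale_pos a b c hc hac hbc).
  (* Here [a_2 = c / (2 a b)] and [a_3 = - K / 4], so the functional equals [- K t]; hence the
     change of sign. *)
  rewrite <- (Rabs_pos_eq (fs_scale a b c)), <- Rabs_mult, <- Rabs_Ropp, <- Cmod_R by lra.
  f_equal.
  apply C_eq; simpl; [|ring]; unfold fs_scale, fs_param; simpl; field; lra.
Qed.

Theorem theorem2p8 (a b c mu : R) (hc : 0 < c) (hac : c <= a) (hbc : c <= b) :
  (forall (f : C -> C) (ak : nat -> C),
     class_R a b c f -> expansion f ak ->
     Cmod (ak 3%nat - RtoC mu * ak 2%nat ^ 2)%C <= fs_bound a b c mu)
  /\
  (exists ak : nat -> C,
     expansion (extremal a b c mu) ak /\
     Cmod (ak 3%nat - RtoC mu * ak 2%nat ^ 2)%C = fs_bound a b c mu).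
Proof.
split.
- intros f ak; now apply fekete_szego_upper.
- rewrite fs_boundE by assumption.
  assert (L := mu_lowE a b c mu hc hac hbc); assert (U := mu_highE a b c mu hc hac hbc).
  assert (A := fekete_szego_out a b c mu hc hac hbc).
  unfold extremal; destruct (Rlt_dec mu (mu_low a b c)) as [H1|H1];
    [|destruct (Rle_dec mu (mu_high a b c)) as [H2|H2]].
  + rewrite Rmax_right; [exact A|]; rewrite Rabs_left; lra.
  + rewrite Rmax_left, Rmult_1_r; [now apply fekete_szego_mid|]; apply Rabs_le; lra.
  + rewrite Rmax_right; [exact A|]; rewrite Rabs_pos_eq; lra.
Qed.
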